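(* Let $(X,\mathcal{LSS}_X)$ and $(Y,\mathcal{LSS}_Y)$ be large scale spaces with bounded scale measure, and let $f:X\to Y$ be a coarse equivalence. If $(Y,\mathcal{LSS}_Y)$ has property A at a scale (i.e. at some uniformly bounded scale $\mathcal{U}_Y\in\mathcal{LSS}_Y$), then $(X,\mathcal{LSS}_X)$ also has property A at a scale (i.e. at some uniformly bounded scale $\mathcal{U}_X\in\mathcal{LSS}_X$).
   Context: For a family $\mathcal{U}$ of subsets of a set $X$ and $V\subseteq X$, the star is $\mathrm{st}(V,\mathcal{U})=\bigcup\{U\in\mathcal{U}: U\cap V\neq\varnothing\}$; for a family $\mathcal{V}$ of subsets, $\mathrm{st}(\mathcal{V},\mathcal{U})=\{\mathrm{st}(V,\mathcal{U}): V\in\mathcal{V}\}$. The horizon of $A\subseteq X$ against $\mathcal{U}$ is $\mathrm{hor}(A,\mathcal{U})=\{U\in\mathcal{U}: A\cap U\neq\varnothing\}$. A large scale structure on $X$ is a non-empty set $\mathcal{LSS}$ of families of subsets of $X$ such that: (1) if $\mathcal{V}\in\mathcal{LSS}$ and $\mathcal{U}$ is a family of subsets of $X$ such that each element of $\mathcal{U}$ consisting of more than one point is contained in some element of $\mathcal{V}$, then $\mathcal{U}\in\mathcal{LSS}$; (2) if $\mathcal{U},\mathcal{V}\in\mathcal{LSS}$, then $\mathrm{st}(\mathcal{U},\mathcal{V})\in\mathcal{LSS}$. The pair $(X,\mathcal{LSS})$ is a large scale space. Elements of $\mathcal{LSS}$ are called uniformly bounded families. A scale of $X$ is a family of subsets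 of $X$ that covers $X$; a uniformly bounded scale is a scale of $X$ belonging to $\mathcal{LSS}$. The trivial cover of $X$ is $\{\{x\}\}_{x\in X}$. A map $f:X\to Y$ between large scale spaces is large scale continuous if $f(\mathcal{U})=\{f(U):U\in\mathcal{U}\}\in\mathcal{LSS}_Y$ for every $\mathcal{U}\in\mathcal{LSS}_X$. Two maps $f,g:X\to Y$ are close if there is $\mathcal{V}\in\mathcal{LSS}_Y$ such that for every $x\in X$ there is $V\in\mathcal{V}$ with $f(x),g(x)\in V$. A large scale continuous map $f:X\to Y$ is a coarse equivalence if there is a large scale continuous map $g:Y\to X$ such that $f\circ g$ is close to $\mathrm{id}_Y$ and $g\circ f$ is close to $\mathrm{id}_X$. Given a scale $\mathcal{U}$ of $X$ and $A\subseteq X$, a $\mathcal{U}$-net of $A$ is a subset $B\subseteq A$ that is maximal (with respect to inclusion) among subsets of $A$ having the property that no two distinct elements of $B$ belong to the same element of $\mathcal{U}$. $(X,\mathcal{LSS})$ has bounded scale measure if there is a uniformly bounded scale $\mathcal{U}\in\mathcal{LSS}$ such that for every uniformly bounded scale $\mathcal{V}\in\mathcal{LSS}$ there exists a natural number $u(\mathcal{V})$ such that for all $V\in\mathcal{V}$, every $\mathcal{U}$-net of $V$ has at most $u(\mathcal{V})$ elements. Let $(X,\mathcal{LSS})$ be a large scale space with bounded scale measure and $\mathcal{U}\in\mathcal{LSS}$ a uniformly bounded scale. $(X,\mathcal{LSS})$ has property A at scale $\mathcal{U}$ if for all $\epsilon>0$ and all $\mathcal{V}\in\mathcal{LSS}$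 that is not the trivial cover there exist a collection of finite subsets $\{A_U\}_{U\in\mathcal{U}}$ with $A_U\subseteq\mathcal{U}\times\mathbb{N}$ for all $U\in\mathcal{U}$, and $\mathcal{W}\in\mathcal{LSS}$, such that: (1) $(U,1)\in A_U$ for all $U\in\mathcal{U}$; (2) $A_U\subseteq\mathrm{hor}(\mathrm{st}(U,\mathcal{W}),\mathcal{U})\times\mathbb{N}$ for all $U\in\mathcal{U}$; (3) $\frac{|A_{U_1}\,\Delta\,A_{U_2}|}{|A_{U_1}\cap A_{U_2}|}<\epsilon$ whenever $U_1,U_2\in\mathcal{U}$ and $\mathrm{hor}(U_1,\mathcal{V})\cap\mathrm{hor}(U_2,\mathcal{V})\neq\varnothing$. Here $\Delta$ denotes symmetric difference. *)

(* Defs.v *)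
From HB Require Import structures.
From mathcomp Require Import all_boot all_order all_algebra finmap.
From mathcomp Require Import all_classical all_reals.

Set Implicit Arguments.
Unset Strict Implicit.
Unset Printing Implicit Defensive.

Import Order.TTheory GRing.Theory Num.Theory.

Local Open Scope classical_set_scope.

Definition star {X : Type} (V : set X) (UU : set (set X)) : set X :=
  \bigcup_(U in [set U | UU U /\ U `&` V !=set0]) U.

Definition star_family {X : Type} (VV UU : set (set X)) : set (set X) :=
  [set star V UU | V in VV].

Definition hor {X : Type} (A : set X) (UU : set (set X)) : set (set X) :=
  [set U | UU U /\ A `&` U !=set0].

Record large_scale_structure {X : Type} (L : set (set (set X))) : Prop := {
  lss_nonempty : L !=set0;
  lss_refine : forall VV UU : set (set X), L VV ->
    (forall U, UU U -> (exists x y, [/\ U x, U y & x <> y]) ->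
       exists2 V, VV V & U `<=` V) ->
    L UU;
  lss_star : forall UU VV : set (set X), L UU -> L VV -> L (star_family UU VV)
}.

Definition is_scale {X : Type} (UU : set (set X)) : Prop :=
  forall x : X, exists2 U, UU U & U x.

Definition uniformly_bounded_scale {X : Type} (L : set (set (set X)))
    (UU : set (set X)) : Prop :=
  is_scale UU /\ L UU.

Definition trivial_cover (X : Type) : set (set X) := [set [set x] | x in setT].

Definition image_family {X Y : Type} (f : X -> Y) (UU : set (set X)) :
    set (set Y) :=
  [set f @` U | U in UU].

Definition ls_continuous {X Y : Type} (LX : set (set (set X)))
    (LY : set (set (set Y))) (f : X -> Y) : Prop :=
  forall UU, LX UU -> LY (image_family f UU).

Definition close_maps {X Y : Type} (LY : set (set (set Y))) (f g : X -> Y) : Prop :=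
  exists2 VV, LY VV & forall x, exists V, [/\ VV V, V (f x) & V (g x)].

Definition coarse_equivalence {X Y : Type} (LX : set (set (set X)))
    (LY : set (set (set Y))) (f : X -> Y) : Prop :=
  ls_continuous LX LY f /\
  exists g : Y -> X,
    [/\ ls_continuous LY LX g, close_maps LY (f \o g) id & close_maps LX (g \o f) id].

Definition scale_separated {X : Type} (UU : set (set X)) (B : set X) : Prop :=
  forall x y, B x -> B y -> x <> y -> ~ exists U, [/\ UU U, U x & U y].

Definition is_net {X : Type} (UU : set (set X)) (A B : set X) : Prop :=
  [/\ B `<=` A, scale_separated UU B &
      forall C, C `<=` A -> scale_separated UU C -> B `<=` C -> C = B].

Definition bounded_scale_measure {X : Type} (L : set (set (set X))) : Prop :=
  exists2 UU, uniformly_bounded_scale L UU &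
    forall VV, uniformly_bounded_scale L VV ->
      exists u : nat, forall V, VV V -> forall B, is_net UU V B ->
        (B #<= `I_u)%card.

Definition fsymdiff {T : choiceType} (A B : {fset T}) : {fset T} :=
  ((A `\` B) `|` (B `\` A))%fset.

(* The collection (A_U) is a function on all subsets of X; only its values on
   UU matter.  As division by zero is 0, the positivity of #|A_U1 :&: A_U2|,
   implicit in writing the quotient, is required separately. *)
Definition property_A_at (R : realType) {X : Type} (L : set (set (set X)))
    (UU : set (set X)) : Prop :=
  forall eps : R, (0 < eps)%R ->
  forall VV : set (set X), L VV -> VV <> @trivial_cover X ->
  exists (A : set X -> {fset (set X * nat)%type}) (WW : set (set X)),
    [/\ L WW,
        forall U, UU U -> [set` A U] `<=` UU `*` [set: nat],
        forall U, UU U -> (U, 1%N) \in A U,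
        forall U, UU U -> [set` A U] `<=` hor (star U WW) UU `*` [set: nat] &
        forall U1 U2, UU U1 -> UU U2 -> hor U1 VV `&` hor U2 VV !=set0 ->
          (0 < #|` (A U1 `&` A U2)%fset|)%N /\
          (#|` fsymdiff (A U1) (A U2)|%:R / #|` (A U1 `&` A U2)%fset|%:R
             < eps)%R].

Definition has_property_A_at_a_scale (R : realType) {X : Type}
    (L : set (set (set X))) : Prop :=
  exists2 UU, uniformly_bounded_scale L UU & property_A_at R L UU.

(* Main.v *)
Require Import Defs.
From HB Require Import structures.
From mathcomp Require Import all_boot all_order all_algebra finmap.
From mathcomp Require Import all_classical all_reals.

(** The scale chosen on [X] is the family of non-empty preimages [f @^-1` V]
    of the elements [V] of the given scale [UY] of [Y]; it is uniformly bounded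
    because preimages under a coarse equivalence of uniformly bounded families
    are uniformly bounded ([preimage_family_bounded]).

    The finite sets [A V] on [Y] are transported to [X] along a map [p] from
    [UY] to the new scale.  It sends [V] to its preimage when that is not
    empty; the other elements of [UY] are missed by [f], and [p] sends such a
    [V] to the preimage of an element that contains [f (g y)] for some [y] in
    [V], which is close to [V].  The map [p] may be infinite-to-one, so
    the sets [A V] cannot be moved by an injection of all labelled elements.
    Only multiplicities are transported: the new set contains [(W, 1), ..., (W, m)],
    where [m] counts the elements of the old set lying over [W] ([push]).  This
    operation preserves cardinality and inclusion, hence it can only enlarge
    intersections and shrink symmetric differences, so the quotient in
    property A does not increase ([push_ratio]).

    Finally, a family [VV] on [X] is tested on [Y] by its image under [f].  That
    image may be the trivial cover, which property A excludes; adding the empty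
    set to it changes no horizon and makes it different from the trivial cover
    ([property_A_at_any_family]). *)

Set Implicit Arguments.
Unset Strict Implicit.
Unset Printing Implicit Defensive.

Import Order.TTheory GRing.Theory Num.Theory.

Local Open Scope classical_set_scope.

(** * Transporting finite sets by multiplicities *)

Section Push.
Variables (T S : choiceType) (p : T -> S).
Implicit Types (s : seq T) (A B : {fset T}).

Let mult s w := count (fun t => p t == w) s.

(* Reading the list from the end, each element over [w] receives the next free
   label over [w], starting from 1. *)
Fixpoint push_seq s : seq (S * nat) :=
  if s is t :: s' then (p t, (mult s' (p t)).+1) :: push_seq s' else [::].

Definition push A : {fset S * nat} := [fset x in push_seq A]%fset.

Lemma mem_push_seq s w k : ((w, k) \in push_seq s) = (0 < k <= mult s w)%N.
Proof.
elim: s => [|t s IHs] /=; first by case: k.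
rewrite in_cons IHs xpair_eqE [w == _]eq_sym.
case: eqVneq => [->|_] //=.
rewrite add1n [(k <= _.+1)%N]leq_eqVlt ltnS.
by case: eqVneq => // ->.
Qed.

Lemma size_push_seq s : size (push_seq s) = size s.
Proof. by elim: s => //= t s ->. Qed.

Lemma push_seq_uniq s : uniq (push_seq s).
Proof.
by elim: s => //= t s ->; rewrite mem_push_seq ltnn andbF.
Qed.

Lemma mem_push A w k : ((w, k) \in push A) = (0 < k <= mult A w)%N.
Proof. by rewrite inE /= mem_push_seq. Qed.

Lemma card_push A : #|` push A| = #|` A|.
Proof.
rewrite card_fseq undup_id ?push_seq_uniq //.
exact: size_push_seq.
Qed.

Lemma push_over A w k : (w, k) \in push A -> exists2 t, t \in A & p t = w.
Proof.
rewrite mem_push => /andP[k0 /(leq_trans k0)].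
by rewrite -has_count => /hasP[t tA /eqP]; exists t.
Qed.

Lemma mem_push1 A t : t \in A -> (p t, 1%N) \in push A.
Proof. by move=> tA; rewrite mem_push -has_count /=; apply/hasP; exists t. Qed.

(** The label set over each point is an initial segment, so it only depends on
    the multiplicity, which grows with the set. *)
Lemma push_subset A B : (A `<=` B)%fset -> (push A `<=` push B)%fset.
Proof.
move=> /fsubsetP AB; apply/fsubsetP => -[w k]; rewrite !mem_push.
case/andP=> -> /= /leq_trans; apply.
rewrite /mult -!size_filter uniq_leq_size ?filter_uniq ?fset_uniq //.
by move=> t; rewrite !mem_filter => /andP[-> /AB].
Qed.

Lemma card_push_fsetI A B : (#|` A `&` B| <= #|` push A `&` push B|)%N%fset.
Proof.
rewrite -card_push; apply: fsubset_leq_card.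
by rewrite fsubsetI !push_subset ?fsubsetIl ?fsubsetIr.
Qed.

Lemma card_fsymdiff (K : choiceType) (C D : {fset K}) :
  (#|` fsymdiff C D| + #|` C `&` D|.*2 = #|` C| + #|` D|)%N%fset.
Proof.
have disj : [disjoint C `\` D & D `\` C]%fset.
  by apply/fdisjointP => x; rewrite !inE => /andP[/negPf-> ->]; rewrite andbF.
rewrite /fsymdiff cardfsU (disjoint_fsetI0 disj) cardfs0 subn0.
rewrite -(cardfsID D C) -(cardfsID C D).
by rewrite [(D `&` C)%fset]fsetIC -addnn [RHS]addnACA addnC.
Qed.

Lemma card_push_fsymdiff A B :
  (#|` fsymdiff (push A) (push B)| <= #|` fsymdiff A B|)%N.
Proof.
rewrite -(leq_add2r #|` A `&` B|%fset.*2) card_fsymdiff -(card_push A).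
rewrite -(card_push B) -card_fsymdiff leq_add2l leq_double.
exact: card_push_fsetI.
Qed.

Lemma push_ratio (R : realType) (eps : R) A B :
  (0 < #|` (A `&` B)%fset|)%N /\
    (#|` fsymdiff A B|%:R / #|` (A `&` B)%fset|%:R < eps)%R ->
  (0 < #|` (push A `&` push B)%fset|)%N /\
    (#|` fsymdiff (push A) (push B)|%:R
       / #|` (push A `&` push B)%fset|%:R < eps)%R.
Proof.
move=> [I0 lt_eps]; have pI0 := leq_trans I0 (card_push_fsetI A B).
split=> //; apply: le_lt_trans lt_eps.
apply: ler_pM; rewrite ?invr_ge0 ?ler0n ?ler_nat ?card_push_fsymdiff //.
by rewrite lef_pV2 ?posrE ?ltr0n // ler_nat card_push_fsetI.
Qed.

End Push.

(** * Uniformly bounded families and coarse equivalences *)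

Lemma lss_sub X (L : set (set (set X))) UU VV : large_scale_structure L ->
  L VV -> (forall U, UU U -> exists2 V, VV V & U `<=` V) -> L UU.
Proof. by move=> hL LVV UV; apply: (lss_refine hL LVV) => U /UV. Qed.

Lemma lss_setU0 X (L : set (set (set X))) VV : large_scale_structure L ->
  L VV -> L (VV `|` [set set0]).
Proof.
move=> hL LVV; apply: (lss_refine hL LVV) => U [VU _|-> [x [y []]]] //.
by exists U.
Qed.

Definition preimage_family X Y (f : X -> Y) (VV : set (set Y)) :
  set (set X) := [set f @^-1` V | V in VV].

(** If [x] lies over [V] then [g (f x)], which is close to [x], lies in
    [g @` V]; hence [f @^-1` V] is contained in a star of [g @` V]. *)
Lemma preimage_family_bounded X Y (LX : set (set (set X)))
    (LY : set (set (set Y))) (f : X -> Y) (g : Y -> X) VV :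
    large_scale_structure LX -> ls_continuous LY LX g ->
    close_maps LX (g \o f) id -> LY VV ->
  LX (preimage_family f VV).
Proof.
move=> hLX cg [HH LHH gfH] LVV.
apply: (lss_sub hLX (lss_star hLX (cg _ LVV) LHH)) => _ [V VV_V <-].
exists (star (g @` V) HH); first by exists (g @` V) => //; exists V.
move=> x Vfx; have [H [HH_H Hgfx Hx]] := gfH x.
by exists H => //; split=> //; exists (g (f x)); split=> //; exists (f x).
Qed.

(** Adding the empty set to [VV] changes no horizon, as the empty set meets
    nothing, and yields a family that is never the trivial cover. *)
Lemma property_A_at_any_family (R : realType) X (L : set (set (set X))) UU (eps : R) VV :
    large_scale_structure L -> property_A_at R L UU -> (0 < eps)%R -> L VV ->
  exists (A : set X -> {fset (set X * nat)%type}) (WW : set (set X)),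
    [/\ L WW,
        forall U, UU U -> (U, 1%N) \in A U,
        forall U, UU U -> [set` A U] `<=` hor (star U WW) UU `*` [set: nat] &
        forall U1 U2, UU U1 -> UU U2 -> hor U1 VV `&` hor U2 VV !=set0 ->
          (0 < #|` (A U1 `&` A U2)%fset|)%N /\
          (#|` fsymdiff (A U1) (A U2)|%:R / #|` (A U1 `&` A U2)%fset|%:R
             < eps)%R].
Proof.
move=> hL hA eps0 /(lss_setU0 hL) LVV0.
have nontriv : VV `|` [set set0] <> @trivial_cover X.
  move=> E; have : (VV `|` [set set0]) set0 by right.
  by rewrite E => -[x _ x0]; have : [set x] x by []; rewrite x0.
have [A [WW [LWW _ A1 Ahor Aeps]]] := hA _ eps0 _ LVV0 nontriv.
exists A, WW; split=> // U1 U2 UU1 UU2 [V [[V1 VU1] [_ VU2]]].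
by apply: Aeps => //; exists V; split; split=> //; left.
Qed.

(** In the application [y] and [y'] are images of points of [X].  Consecutive
    sets of the chain [V], [W], [V'], [K] meet, for some [W] in [WW], so that
    two successive stars around [W] reach both ends: the families involved do
    not depend on the points, which makes the bound uniform. *)
Lemma star_chain Y (UU WW KK : set (set Y)) V V' K y y' z :
    is_scale KK -> UU V -> V y -> hor (star V WW) UU V' ->
    V' z -> KK K -> K z -> K y' ->
  exists B, [/\ star_family (star_family WW UU) KK B, B y & B y'].
Proof.
move=> sKK UUV Vy [UUV' [a [[W [WW_W [b [Wb Vb]]] Wa] V'a]]] V'z KKK Kz Ky'.
exists (star (star W UU) KK); split.
- by exists (star W UU) => //; exists W.
- have [K0 KKK0 K0y] := sKK y; exists K0 => //; split=> //.
  exists y; split=> //; exists V => //; split=> //; by exists b.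
- exists K => //; split=> //; exists z; split=> //.
  by exists V' => //; split=> //; exists a.
Qed.

Definition preimage_scale X Y (f : X -> Y) (UU : set (set Y)) : set (set X) :=
  [set U | preimage_family f UU U /\ U !=set0].

Lemma preimage_scaleP X Y (f : X -> Y) UU x : is_scale UU ->
  exists U, [/\ UU U, U (f x) & preimage_scale f UU (f @^-1` U)].
Proof.
move=> /(_ (f x))[U UUU Ufx].
by exists U; split=> //; split; [exists U | exists x].
Qed.
Arguments preimage_scaleP {X Y} f {UU}.

(** The map along which labels are transported: the preimage where possible,
    and otherwise the preimage of a nearby element, which exists because [f]
    is coarsely surjective. *)
Lemma preimage_scale_retraction X Y (f : X -> Y) (g : Y -> X)
    (UU KK : set (set Y)) :
    is_scale UU -> is_scale KK ->
    (forall y, exists K, [/\ KK K, K (f (g y)) & K y]) ->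
  exists p : set Y -> set X,
    (forall V, f @^-1` V !=set0 -> p V = f @^-1` V) /\
    (forall V, UU V -> V !=set0 -> preimage_scale f UU (p V) /\
       exists x z K, [/\ p V x, V z, KK K, K z & K (f x)]).
Proof.
move=> sUU sKK fgK.
suff /choice[p pP] : forall V, exists W,
    (f @^-1` V !=set0 -> W = f @^-1` V) /\
    (UU V -> V !=set0 -> preimage_scale f UU W /\
       exists x z K, [/\ W x, V z, KK K, K z & K (f x)]).
  by exists p; split=> V; case: (pP V).
move=> V; have [[x Vfx]|V0] := pselect (f @^-1` V !=set0).
  exists (f @^-1` V); split=> // UUV _; split; first by split; [exists V|exists x].
  by have [K KKK Kfx] := sKK (f x); exists x, (f x), K.
have [[z Vz]|nV] := pselect (V !=set0); last by exists set0.
have [K [KKK Kfgz Kz]] := fgK z.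
have [U [UUU Ufgz sU]] := preimage_scaleP f (g z) sUU.
by exists (f @^-1` U); split=> // _ _; split=> //; exists (g z), z, K.
Qed.

(** * Invariance of property A *)

Theorem theorem3p7 (R : realType) (X Y : Type)
    (LX : set (set (set X))) (LY : set (set (set Y)))
    (hLX : large_scale_structure LX) (hLY : large_scale_structure LY)
    (hX : bounded_scale_measure LX) (hY : bounded_scale_measure LY)
    (f : X -> Y) (hf : coarse_equivalence LX LY f) :
  has_property_A_at_a_scale R LY -> has_property_A_at_a_scale R LX.
Proof.
move=> [UY [sUY LUY] hA].
have [cf [g [cg [KK LKK fgK] gfX]]] := hf.
have sKK : is_scale KK by move=> y; have [K [KKK _ Ky]] := fgK y; exists K.
have preLX VV : LY VV -> LX (preimage_family f VV).
  exact: preimage_family_bounded hLX cg gfX.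
have [p [p_pre p_near]] := 
  preimage_scale_retraction (f := f) (g := g) sUY sKK fgK.
pose UX := preimage_scale f UY.
have /choice[s sP] : forall U, exists V, UX U -> UY V /\ f @^-1` V = U.
  move=> U; have [[[V UYV <-] _]|nU] := pselect (UX U); first by exists V.
  by exists set0.
have ps U : UX U -> p (s U) = U.
  by move=> UXU; have [_ sU] := sP U UXU; rewrite p_pre sU //; case: UXU.
exists UX.
  split=> [x|].
    by have [U [_ Ufx UXU]] := preimage_scaleP f x sUY; exists (f @^-1` U).
  by apply: (lss_sub hLX (preLX _ LUY)) => U [UXU _]; exists U.
move=> eps eps0 VV LVV _.
have [A [WW [LWW A1 Ahor Aeps]]] := property_A_at_any_family hLY hA eps0 (cf _ LVV).
pose BB := star_family (star_family WW UY) KK.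
have LBB : LY BB by apply: lss_star => //; apply: lss_star.
pose AX U := push (fun t : set Y * nat => p t.1) (A (s U)).
have AXhor U : UX U ->
    [set` AX U] `<=` hor (star U (preimage_family f BB)) UX `*` [set: nat].
  move=> UXU [W k] /= /push_over[[V n] AV /= <-]; split=> //=.
  have [UYsU fsU] := sP U UXU; have [_ [x Ux]] := UXU.
  have sUfx : s U (f x) by rewrite -fsU in Ux.
  have [hV _] := Ahor _ UYsU _ AV.
  have [/= UYV [y [_ Vy]]] := hV.
  have V0 : V !=set0 by exists y.
  have [UXpV [x' [z [K [pVx' Vz KKK Kz Kfx']]]]] := p_near V UYV V0.
  have [B [BB_B Bfx Bfx']] := star_chain sKK UYsU sUfx hV Vz KKK Kz Kfx'.
  split=> //; exists x'; split=> //.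
  by exists (f @^-1` B) => //; split; [exists B | exists x].
have hor_image U V : UX U -> hor U VV V ->
    hor (s U) (image_family f VV) (f @` V).
  move=> UXU [VV_V [x [Ux Vx]]]; have [_ fsU] := sP U UXU.
  split; first by exists V.
  by rewrite -fsU in Ux; exists (f x); split=> //; exists x.
exists AX, (preimage_family f BB); split=> //.
- exact: preLX.
- by move=> U UXU t /(AXhor U UXU)[[UXt _] _].
- by move=> U UXU; rewrite -{1}(ps U UXU); apply: mem_push1 (A1 _ (sP U UXU).1).
- move=> U1 U2 UX1 UX2 [V [h1 h2]]; apply: push_ratio.
  apply: Aeps (sP _ UX1).1 (sP _ UX2).1 _.
  by exists (f @` V); split; apply: hor_image.
Qed.
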